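(* Let $G \in \widetilde{\mathbb{G}}$. Put $M:=\max_{G^L}\{\rho_0(G^L)\}$ and $m:=\min_{G^R}\{\lambda_0(G^R)\}$, with the conventions $\max\emptyset=-\infty$ and $\min\emptyset=+\infty$. Consider the following conditions on a Left option $G^L$ or a Right option $G^R$ of $G$: (i) $M\in\mathbb{Z}$, and $G^L$ is equal to $M$. (ii) $M\in\mathbb{Z}$, and $G^L$ satisfies $\rho_0(G^L)=M$ although $G^L$ is not equal to an integer; furthermore, $s\mapsto\widetilde{\rho}_s(G^L)$ has slope $0$ on $s\in(-\delta,0]$, where $\delta$ is a sufficiently small positive number such that the slope is uniquely determined. (iii) $m\in\mathbb{Z}$, and $G^R$ is equal to $m$. (iv) $m\in\mathbb{Z}$, and $G^R$ satisfies $\lambda_0(G^R)=m$ although $G^R$ is not equal to an integer; furthermore, $s\mapsto\widetilde{\lambda}_s(G^R)$ has slope $0$ on $s\in(-\delta,0]$, where $\delta$ is a sufficiently small positive number such that the slope is uniquely determined. Let $l:=M+1$ if there exists a $G^L$ satisfying (i) or (ii), and $l:=M$ otherwise. Let $r:=m-1$ if there exists a $G^R$ satisfying (iii) or (iv), and $r:=m$ otherwise. Let $$S:=\{n\in\mathbb{Z}\mid l\le n\le r\}.$$ Then: 1. If $S=\emptyset$, then $G$ is not equal to an integer. 2. Otherwise, $G$ is equal to the (unique) $n\in S$ whose absolute value attains the minimum of $\{|k| \mid k\in S\}$.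
   Context: Games. $\widetilde{\mathbb{G}}$ is the set of all formal (short, i.e. finite loopfree) normal-play partizan games $G=\{G^L\mid G^R\}$, where $G^L$ (resp. $G^R$) ranges over the finitely many Left (resp. Right) options of $G$; $\tilde b(G)$ is the formal birthday (height of the game tree). Sums and negatives of games are the usual ones; $G\ge 0$ means Left wins $G$ moving second under normal play, $G\ge H$ means $G-H\ge 0$, and $G$ is equal to $H$ (equality of game values) if $G\ge H$ and $H\ge G$. The dyadic rationals $\mathbb{Z}[\frac12]$ are identified in the usual way with the numbers among game values; ''equal to an integer/number'' means having such a game value. When a dyadic rational is used as a formal game, its canonical form is meant. Cooling and temperature. For $G\in\widetilde{\mathbb{G}}$ and $t\in\mathbb{Z}[\frac12]$, define $\lambda_t(G),\rho_t(G)\in\mathbb{Z}[\frac12]$, $G_t\in\widetilde{\mathbb{G}}$ and $t(G)\in\mathbb{Z}[\frac12]\cup\{-\infty\}$ by recursion on $\tilde b(G)$ (this recursion is well-defined): - If $G$ is equal to an integer $n$: $\lambda_t(G)=\rho_t(G)=n$, $G_t=n$ (canonical form), $t(G)=-\infty$. - Otherwise let $\widetilde{\lambda}_t(G)=\max_{G^L}\{\rho_t(G^L)-t\}$, $\widetilde{\rho}_t(G)=\min_{G^R}\{\lambda_t(G^R)+t\}$, $\widetilde{G}_t=\{(G^L)_t-t\mid (G^R)_t+t\}$ (with all $G^L$, $G^R$), and $t(G)=\min\{t\in\mathbb{Z}[\frac12]\mid \widetilde{\lambda}_t(G)=\widetilde{\rho}_t(G)\}$. If $t\le t(G)$, set $\lambda_t(G)=\widetilde{\lambda}_t(G)$,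 $\rho_t(G)=\widetilde{\rho}_t(G)$, $G_t=\widetilde{G}_t$. If $t>t(G)$, set $\lambda_t(G)=\rho_t(G)=x$ and $G_t=x$ (canonical form), where $x=\lambda_{t(G)}(G)=\rho_{t(G)}(G)$. For $G$ not equal to an integer, $\widetilde{\lambda}_t(G)$ and $\widetilde{\rho}_t(G)$ are continuous piecewise linear functions of $t\in\mathbb{Z}[\frac12]$ with finitely many pieces, with slopes in $\{0,-1\}$ and $\{0,1\}$ respectively, so the slope on $(-\delta,0]$ is well-defined for all sufficiently small $\delta>0$. *)

(* Defs.v *)
From HB Require Import structures.
From mathcomp Require Import all_boot all_order all_algebra.
From mathcomp Require Import boolp classical_sets constructive_ereal.

Set Implicit Arguments.
Unset Strict Implicit.
Unset Printing Implicit Defensive.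

Import Order.TTheory GRing.Theory Num.Theory.
Local Open Scope classical_set_scope.
Local Open Scope ring_scope.

(* The order and the repetition of options in the lists below are irrelevant to
   all the notions defined in this file. *)
Inductive game : Type := Game of seq game & seq game.

HB.instance Definition _ := gen_eqMixin game.

Definition left_options (G : game) : seq game := let: Game L _ := G in L.
Definition right_options (G : game) : seq game := let: Game _ R := G in R.

Fixpoint game_opp (G : game) : game :=
  let: Game GL GR := G in Game (map game_opp GR) (map game_opp GL).

Fixpoint game_add (G : game) : game -> game :=
  let: Game GL GR := G in
  fix game_add_G (H : game) : game :=
    let: Game HL HR := H in
    Game ([seq game_add g (Game HL HR) | g <- GL] ++ map game_add_G HL)
         ([seq game_add g (Game HL HR) | g <- GR] ++ map game_add_G HR).

Definition game_sub (G H : game) : game := game_add G (game_opp H).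

Fixpoint left_wins_second (G : game) : bool :=
  let: Game _ GR := G in all left_wins_first GR
with left_wins_first (G : game) : bool :=
  let: Game GL _ := G in has left_wins_second GL.

Definition game_ge (G H : game) : bool := left_wins_second (game_sub G H).

(* Equality of game values, as opposed to the equality [=] of formal games. *)
Definition game_eqv (G H : game) : bool := game_ge G H && game_ge H G.

Definition game_of_nat (n : nat) : game :=
  iter n (fun G => Game [:: G] [::]) (Game [::] [::]).

Definition game_of_int (z : int) : game :=
  match z with
  | Posz n => game_of_nat n
  | Negz n => game_opp (game_of_nat n.+1)
  end.

Definition equal_to_integer (G : game) : Prop :=
  exists n : int, game_eqv G (game_of_int n).

(* The integer (unique, up to game value) to which [G] is equal; [0] if there is
   none. *)
Definition integer_value (G : game) : int :=
  xget 0 [set n : int | game_eqv G (game_of_int n)].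

Definition dyadic : set rat :=
  [set x | exists (m : int) (k : nat), x = m%:~R / 2 ^+ k].

(* The least dyadic rational at which [f] and [g] agree; [0] if there is none. *)
Definition first_agreement (f g : rat -> \bar rat) : rat :=
  xget 0 [set t | [/\ dyadic t, f t = g t &
                      forall s, dyadic s -> f s = g s -> t <= s]].

(* [(stops G).1 t] is lambda_t(G) and [(stops G).2 t] is rho_t(G): the two
   functions are defined together by structural recursion, and are named and
   characterized below. They are total on [rat], but only their values at dyadic
   [t] are meaningful. A game that is not equal to an integer has both Left and
   Right options, so that the maximum and the minimum below are then finite and
   [fine] does not lose information. *)
Fixpoint stops (G : game) : (rat -> rat) * (rat -> rat) :=
  let: Game GL GR := G in
  let lt t := \big[maxe/-oo%E]_(f <- [seq (stops g).2 | g <- GL]) (f t - t)%:E in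
  let rt t := \big[mine/+oo%E]_(f <- [seq (stops g).1 | g <- GR]) (f t + t)%:E in
  if `[< equal_to_integer (Game GL GR) >] then
    let n := (integer_value (Game GL GR))%:~R in (fun=> n, fun=> n)
  else
    let t0 := first_agreement lt rt in
    (fun t => if t <= t0 then fine (lt t) else fine (lt t0),
     fun t => if t <= t0 then fine (rt t) else fine (rt t0)).

Definition lambda (t : rat) (G : game) : rat := (stops G).1 t.
Definition rho (t : rat) (G : game) : rat := (stops G).2 t.

Definition lambda_tilde (t : rat) (G : game) : \bar rat :=
  \big[maxe/-oo%E]_(g <- left_options G) (rho t g - t)%:E.
Definition rho_tilde (t : rat) (G : game) : \bar rat :=
  \big[mine/+oo%E]_(g <- right_options G) (lambda t g + t)%:E.

Definition temperature (G : game) : \bar rat :=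
  if `[< equal_to_integer G >] then -oo%E
  else (first_agreement (lambda_tilde^~ G) (rho_tilde^~ G))%:E.

Lemma stopsE (G : game) :
  stops G =
  if `[< equal_to_integer G >] then
    (fun=> (integer_value G)%:~R, fun=> (integer_value G)%:~R)
  else
    let t0 := first_agreement (lambda_tilde^~ G) (rho_tilde^~ G) in
    (fun t => if t <= t0 then fine (lambda_tilde t G) else fine (lambda_tilde t0 G),
     fun t => if t <= t0 then fine (rho_tilde t G) else fine (rho_tilde t0 G)).
Proof.
case: G => GL GR /=.
have -> : lambda_tilde^~ (Game GL GR) =
    fun t => \big[maxe/-oo%E]_(f <- [seq (stops g).2 | g <- GL]) (f t - t)%:E.
  by apply/funext => t; rewrite big_map.
have -> : rho_tilde^~ (Game GL GR) =
    fun t => \big[mine/+oo%E]_(f <- [seq (stops g).1 | g <- GR]) (f t + t)%:E.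
  by apply/funext => t; rewrite big_map.
case: ifP => // _; congr pair; apply/funext => t.
  by rewrite /lambda_tilde !big_map.
by rewrite /rho_tilde !big_map.
Qed.

Lemma stops_integer (G : game) (t : rat) : equal_to_integer G ->
  lambda t G = (integer_value G)%:~R /\ rho t G = (integer_value G)%:~R.
Proof. by move=> /asboolP GZ; rewrite /lambda /rho stopsE GZ. Qed.

Lemma stops_le_temperature (G : game) (t : rat) : ~ equal_to_integer G ->
  (t%:E <= temperature G)%E ->
  lambda t G = fine (lambda_tilde t G) /\ rho t G = fine (rho_tilde t G).
Proof.
move=> /asboolPn/negbTE GZ; rewrite /lambda /rho /temperature stopsE GZ /=.
by rewrite lee_fin => ->.
Qed.

Lemma stops_gt_temperature (G : game) (t : rat) : ~ equal_to_integer G ->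
  (temperature G < t%:E)%E ->
  lambda t G = lambda (fine (temperature G)) G /\
  rho t G = rho (fine (temperature G)) G.
Proof.
move=> /asboolPn/negbTE GZ; rewrite /lambda /rho /temperature stopsE GZ /=.
by rewrite lte_fin ltNge => /negbTE ->; rewrite lexx.
Qed.

(* [f] is affine with slope [c] on the dyadic points of (-delta, 0], for some
   (equivalently, for every sufficiently small) delta > 0. *)
Definition slope_left_of_0 (f : rat -> \bar rat) (c : rat) : Prop :=
  exists2 delta : rat, 0 < delta &
    forall s, dyadic s -> - delta < s <= 0 -> f s = (f 0%R + (c * s)%:E)%E.

Section IntegerCriterion.
Variable G : game.

Definition max_left : \bar rat :=
  \big[maxe/-oo%E]_(g <- left_options G) (rho 0 g)%:E.
Definition min_right : \bar rat :=
  \big[mine/+oo%E]_(g <- right_options G) (lambda 0 g)%:E.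

Definition cond_i (g : game) : Prop :=
  exists2 n : int, max_left = n%:~R%:E & game_eqv g (game_of_int n).

Definition cond_ii (g : game) : Prop :=
  [/\ exists n : int, max_left = n%:~R%:E,
      (rho 0 g)%:E = max_left,
      ~ equal_to_integer g &
      slope_left_of_0 (rho_tilde^~ g) 0].

Definition cond_iii (g : game) : Prop :=
  exists2 n : int, min_right = n%:~R%:E & game_eqv g (game_of_int n).

Definition cond_iv (g : game) : Prop :=
  [/\ exists n : int, min_right = n%:~R%:E,
      (lambda 0 g)%:E = min_right,
      ~ equal_to_integer g &
      slope_left_of_0 (lambda_tilde^~ g) 0].

Definition lower_bound : \bar rat :=
  if `[< exists2 g, g \in left_options G & cond_i g \/ cond_ii g >]
  then (max_left + 1)%E else max_left.

Definition upper_bound : \bar rat :=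
  if `[< exists2 g, g \in right_options G & cond_iii g \/ cond_iv g >]
  then (min_right - 1)%E else min_right.

Definition candidates : set int :=
  [set n | (lower_bound <= n%:~R%:E)%E /\ (n%:~R%:E <= upper_bound)%E].

End IntegerCriterion.

(* Main.v *)
(* By the simplicity theorem, [G] is equal to an integer iff some integer [n]
   satisfies neither [G^L >= n] nor [n >= G^R] for any option, and [G] is then
   the simplest such [n].  It remains to read off [H >= n] from the stops of an
   option [H].  For every [t], with [c = max(t, -1)],
     [H >= n] implies [rho_t(H) >= n + t - c], and
     not [H >= n] implies [rho_t(H) <= n + c].
   This is proved by induction on [H], simultaneously with the mirror images for
   [lambda]: a non-integer [H] satisfies [H >= n] iff no [H^R] satisfies
   [H^R <= n].  The bounds force [t(H) >= -1/2] for [H] not an integer, so that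
   they survive the cutoff at the temperature.  When [-1 <= t <= 0] they read
   [rho_t(H) >= n] and [rho_t(H) <= n + t]: thus [rho_0(H)] decides [H >= n]
   unless [rho_0(H) = n], in which case the slope of [rho] just below [0] does. *)
Require Import Defs.
From mathcomp Require Import all_boot all_order all_algebra.
From mathcomp Require Import boolp classical_sets constructive_ereal.
From mathcomp Require Import zify lra.

Set Implicit Arguments.
Unset Strict Implicit.
Unset Printing Implicit Defensive.

Import Order.TTheory GRing.Theory Num.Theory.

Local Open Scope classical_set_scope.
Local Open Scope ring_scope.

(** * The order on games *)

(** One more than the formal birthday: the game without options gets 1, and no game gets 0. *)
Fixpoint birthday (G : game) : nat :=
  let: Game GL GR := G in
  (foldr maxn 0 (map birthday GL ++ map birthday GR)).+1.

Lemma mem_foldr_maxn (n : nat) (s : seq nat) :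
  n \in s -> (n <= foldr maxn 0 s)%N.
Proof.
elim: s => //= k s IH; rewrite inE => /orP[/eqP ->|/IH ns].
  by rewrite leq_maxl.
by rewrite leq_max ns orbT.
Qed.

Lemma birthday_left (G g : game) :
  g \in left_options G -> (birthday g < birthday G)%N.
Proof.
case: G => GL GR /= gL; rewrite ltnS mem_foldr_maxn // mem_cat.
by rewrite map_f.
Qed.

Lemma birthday_right (G g : game) :
  g \in right_options G -> (birthday g < birthday G)%N.
Proof.
case: G => GL GR /= gR; rewrite ltnS mem_foldr_maxn // mem_cat.
by rewrite orbC map_f.
Qed.

Lemma birthday_ind (P : game -> Prop) :
  (forall G, (forall H, (birthday H < birthday G)%N -> P H) -> P G) ->
  forall G, P G.
Proof.
move=> IH G; have [n] := ubnP (birthday G).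
elim: n G => // n IHn G Gn; apply: IH => H HG; apply: IHn; lia.
Qed.

Lemma birthday_ind2 (P : game -> game -> Prop) :
  (forall G H, (forall G' H',
      (birthday G' + birthday H' < birthday G + birthday H)%N -> P G' H') ->
    P G H) ->
  forall G H, P G H.
Proof.
move=> IH G H; have [n] := ubnP (birthday G + birthday H).
elim: n G H => // n IHn G H GHn; apply: IH => G' H' GH'; apply: IHn; lia.
Qed.

Lemma left_options_opp (G : game) :
  left_options (game_opp G) = map game_opp (right_options G).
Proof. by case: G. Qed.

Lemma right_options_opp (G : game) :
  right_options (game_opp G) = map game_opp (left_options G).
Proof. by case: G. Qed.

Lemma game_oppK : involutive game_opp.
Proof.
elim/birthday_ind => -[GL GR] IH /=; congr Game; rewrite -map_comp map_id_in //.
  by move=> g gL; apply: IH; exact: birthday_left.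
by move=> g gR; apply: IH; exact: birthday_right.
Qed.

Lemma birthday_opp (G : game) : birthday (game_opp G) = birthday G.
Proof.
elim/birthday_ind: G => -[GL GR] IH /=; congr S.
have E : forall s : seq game,
    (forall g, g \in s -> (birthday g < birthday (Game GL GR))%N) ->
    map birthday (map game_opp s) = map birthday s.
  by move=> s sG; rewrite -map_comp; apply/eq_in_map => g /sG /IH.
rewrite !E; last 2 first.
- by move=> g; exact: (@birthday_left (Game GL GR)).
- by move=> g; exact: (@birthday_right (Game GL GR)).
have foldr_maxn_cat s1 s2 :
    foldr maxn 0%N (s1 ++ s2) = maxn (foldr maxn 0%N s1) (foldr maxn 0%N s2).
  by elim: s1 => [|n s1 /= ->]; rewrite ?max0n ?maxnA.
by rewrite !foldr_maxn_cat maxnC.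
Qed.

Lemma left_options_sub (G H : game) :
  left_options (game_sub G H) =
  [seq game_sub g H | g <- left_options G] ++
  [seq game_sub G h | h <- right_options H].
Proof. by case: G H => [GL GR] [HL HR] /=; rewrite -map_comp. Qed.

Lemma right_options_sub (G H : game) :
  right_options (game_sub G H) =
  [seq game_sub g H | g <- right_options G] ++
  [seq game_sub G h | h <- left_options H].
Proof. by case: G H => [GL GR] [HL HR] /=; rewrite -map_comp. Qed.

Lemma left_wins_firstE (G : game) :
  left_wins_first G = has left_wins_second (left_options G).
Proof. by case: G. Qed.

Lemma left_wins_secondE (G : game) :
  left_wins_second G = all left_wins_first (right_options G).
Proof. by case: G. Qed.

(** Determinacy of [G - H] with Left to move: if Left does not win, Right does, and then Left wins
    [H - G] moving second. *)
Lemma left_wins_first_sub (G H : game) :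
  left_wins_first (game_sub G H) = ~~ game_ge H G.
Proof.
move: G H; apply: birthday_ind2 => G H IH.
rewrite /game_ge left_wins_firstE left_wins_secondE.
rewrite left_options_sub right_options_sub.
rewrite has_cat all_cat !has_map !all_map negb_and orbC -!has_predC.
congr (_ || _); apply: eq_in_has => g gO /=.
  by rewrite IH ?negbK // addnC ltn_add2l; exact: birthday_right.
by rewrite IH ?negbK // addnC ltn_add2r; exact: birthday_left.
Qed.

(** The recursive form of the order, which replaces sums from here on. *)
Lemma game_geE (G H : game) :
  game_ge G H = all (fun g => ~~ game_ge H g) (right_options G) &&
                all (fun h => ~~ game_ge h G) (left_options H).
Proof.
rewrite {1}/game_ge left_wins_secondE right_options_sub all_cat !all_map.
by congr (_ && _); apply: eq_all => g /=; rewrite left_wins_first_sub.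
Qed.

Lemma game_geP (G H : game) :
  reflect ((forall g, g \in right_options G -> ~~ game_ge H g) /\
           (forall h, h \in left_options H -> ~~ game_ge h G))
          (game_ge G H).
Proof.
rewrite game_geE.
by apply: (iffP andP) => -[/allP GR /allP HL]; split.
Qed.

Lemma game_ge_refl (G : game) : game_ge G G.
Proof.
elim/birthday_ind: G => G IH; apply/game_geP; split=> g gG; apply/negP => /game_geP[gR gL].
  by have := gR _ gG; rewrite IH ?birthday_right.
by have := gL _ gG; rewrite IH ?birthday_left.
Qed.

(** If [K >= g] for a Right option [g] of [G], induction on [H >= K >= g] gives [H >= g], contrary
    to [G >= H]. Left options of [K] are treated likewise. *)
Lemma game_ge_trans (H G K : game) :
  game_ge G H -> game_ge H K -> game_ge G K.
Proof.
have [n] := ubnP (birthday G + birthday H + birthday K).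
elim: n G H K => // n IH G H K GHKn GH HK; apply/game_geP; split=> g gO.
  apply/negP => Kg; have /game_geP[/(_ _ gO)/negP + _] := GH; apply.
  by apply: (IH _ K) => //; have := birthday_right gO; lia.
apply/negP => gG; have /game_geP[_ /(_ _ gO)/negP] := HK; apply.
by apply: (IH _ G) => //; have := birthday_left gO; lia.
Qed.

Lemma game_left_ge (G g : game) : g \in left_options G -> ~~ game_ge g G.
Proof. by move=> gL; have /game_geP[_ ->] := game_ge_refl G. Qed.

Lemma game_right_ge (G g : game) : g \in right_options G -> ~~ game_ge G g.
Proof. by move=> gR; have /game_geP[->] := game_ge_refl G. Qed.

Lemma game_ge_opp (G H : game) :
  game_ge (game_opp G) (game_opp H) = game_ge H G.
Proof.
move: G H; apply: birthday_ind2 => G H IH.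
rewrite game_geE [RHS]game_geE left_options_opp right_options_opp !all_map andbC.
congr (_ && _); apply: eq_in_all => g gO /=.
  by rewrite addnC in IH *; rewrite IH // ltn_add2r birthday_right.
by rewrite addnC in IH *; rewrite IH // ltn_add2l birthday_left.
Qed.

(** * Integers and the simplicity theorem *)

Lemma game_of_intN (n : int) : game_of_int (- n) = game_opp (game_of_int n).
Proof.
by case: n => [[|n]|n] //; rewrite -[LHS]game_oppK.
Qed.

Lemma game_ge_nat (m n : nat) :
  game_ge (game_of_nat m) (game_of_nat n) = (n <= m)%N.
Proof.
have R0 k : right_options (game_of_nat k) = [::] by case: k.
have [k] := ubnP (m + n); elim: k m n => // k IH m [|n] mnk.
  by rewrite game_geE R0.
rewrite game_geE R0 /= andbT IH; last by lia.
by rewrite -ltnNge.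
Qed.

Lemma game_ge_int (m n : int) :
  game_ge (game_of_int m) (game_of_int n) = (n <= m).
Proof.
case: m n => m [] n.
- by rewrite /= game_ge_nat lez_nat.
- by case: m => [|m]; rewrite game_geE.
- by rewrite game_geE /= game_geE; case: n => [|n] /=; case: m.
- by rewrite [LHS]game_ge_opp game_ge_nat; lia.
Qed.

Lemma game_eqv_int_inj (G : game) (m n : int) :
  game_eqv G (game_of_int m) -> game_eqv G (game_of_int n) -> m = n.
Proof.
move=> /andP[Gm mG] /andP[Gn nG]; apply/eqP; rewrite eq_le.
by rewrite -2!game_ge_int (game_ge_trans nG) // (game_ge_trans mG).
Qed.

Lemma integer_valueE (G : game) (n : int) :
  game_eqv G (game_of_int n) -> integer_value G = n.
Proof.
move=> Gn; rewrite /integer_value; case: xgetP => [m _ /= Gm|/(_ n)] //.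
exact: game_eqv_int_inj Gm Gn.
Qed.

Lemma game_eqv_opp (G : game) (n : int) :
  game_eqv (game_opp G) (game_of_int n) = game_eqv G (game_of_int (- n)).
Proof.
by rewrite /game_eqv -{1 2}[n]opprK (game_of_intN (- n)) !game_ge_opp andbC.
Qed.

Lemma equal_to_integer_opp (G : game) :
  equal_to_integer (game_opp G) <-> equal_to_integer G.
Proof.
split=> -[n]; first by rewrite game_eqv_opp; exists (- n).
by exists (- n); rewrite game_eqv_opp opprK.
Qed.

Lemma integer_value_opp (G : game) : equal_to_integer G ->
  integer_value (game_opp G) = - integer_value G.
Proof.
move=> [n Gn]; rewrite (integer_valueE Gn); apply: integer_valueE.
by rewrite game_eqv_opp opprK.
Qed.

(** The betweenness condition of the simplicity theorem; [candidatesE] identifies it with membership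
    in [S]. *)
Definition fits (G : game) (n : int) : Prop :=
  (forall g, g \in left_options G -> ~~ game_ge g (game_of_int n)) /\
  (forall g, g \in right_options G -> ~~ game_ge (game_of_int n) g).

Lemma fits_opp (G : game) (n : int) : fits (game_opp G) n <-> fits G (- n).
Proof.
rewrite /fits left_options_opp right_options_opp; split=> -[GL GR]; split=> g gO.
- by rewrite -game_ge_opp -game_of_intN opprK; apply: GR; rewrite map_f.
- by rewrite -game_ge_opp -game_of_intN opprK; apply: GL; rewrite map_f.
- case/mapP: gO => h hO ->; rewrite -[n]opprK game_of_intN game_ge_opp.
  exact: GR.
- case/mapP: gO => h hO ->; rewrite -[n]opprK game_of_intN game_ge_opp.
  exact: GL.
Qed.

Lemma eqv_fits (G : game) (n : int) : game_eqv G (game_of_int n) -> fits G n.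
Proof.
move=> /andP[Gn nG]; split=> g gO; apply/negP => gn.
  by have /negP := game_left_ge gO; apply; apply: game_ge_trans gn nG.
by have /negP := game_right_ge gO; apply; apply: game_ge_trans Gn gn.
Qed.

(* If [n - 1 >= G], then [n - 1] lies between the options of [G] as well. *)
Lemma ge_or_fits_pred (G : game) (n : int) :
  (forall g, g \in right_options G -> ~~ game_ge (game_of_int n) g) ->
  game_ge G (game_of_int n) \/ 0 < n /\ fits G (n - 1).
Proof.
(* The canonical form of an integer [<= 0] has no Left options, so the hypothesis suffices; that of
   a positive integer has its predecessor as only Left option. *)
case: n => [[|n]|n] GR.
- by left; apply/game_geP.
- have [nG|nG] := boolP (game_ge (game_of_int n) G); last first.
    left; apply/game_geP; split=> // g /=; rewrite inE => /eqP ->.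
    exact: nG.
  right; split=> //; have -> : Posz n.+1 - 1 = n by lia.
  split=> g gO; apply/negP => gn.
    by have /negP := game_left_ge gO; apply; apply: game_ge_trans gn nG.
  have /negP := GR _ gO; apply; apply: game_ge_trans gn.
  by rewrite game_ge_int lez_nat.
- by left; apply/game_geP; split.
Qed.

(** Were [G >= n] to fail, [n] would be positive and [n - 1] a fit of smaller absolute value. The
    other inequality is this argument for [-G] and [-n]. *)
Lemma simplest_fit_eqv (G : game) (n : int) : fits G n ->
  (forall k, fits G k -> `|n| <= `|k|) -> game_eqv G (game_of_int n).
Proof.
move=> Gn minn; apply/andP; split.
  have [_ /ge_or_fits_pred[//|[n0 /minn]]] := Gn; lia.
have /fits_opp : fits (game_opp (game_opp G)) n by rewrite game_oppK.
move=> [_ /ge_or_fits_pred[|[n0]]].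
  by rewrite game_of_intN game_ge_opp.
by move=> /fits_opp /minn; lia.
Qed.

Lemma simplest_fit (G : game) (n : int) : fits G n ->
  exists2 m, fits G m & forall k, fits G k -> `|m| <= `|k|.
Proof.
move=> Gn; pose p k := `[< exists2 m, fits G m & `|m|%N = k >].
have p_n : exists k, p k by exists `|n|%N; apply/asboolP; exists n.
case: (ex_minnP p_n) => k /asboolP[m Gm <-] minm; exists m => // j Gj.
have : p `|j|%N by apply/asboolP; exists j.
by move=> /minm; lia.
Qed.

Lemma fits_integer (G : game) (n : int) : fits G n -> equal_to_integer G.
Proof.
move=> /simplest_fit[m Gm minm]; exists m; exact: simplest_fit_eqv.
Qed.

(* A right option [<= n] is the only way for [G >= n] to fail: the other one,
   [n - 1 >= G], would make [G] an integer. *)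
Lemma integer_avoidance (G : game) (n : int) : ~ equal_to_integer G ->
  ~~ game_ge G (game_of_int n) ->
  exists2 g, g \in right_options G & game_ge (game_of_int n) g.
Proof.
move=> GZ Gn; apply/hasP; apply: contraNT Gn => /hasPn GR.
by have [//|[_ /fits_integer]] := ge_or_fits_pred GR.
Qed.

Lemma ge_of_birthday (G : game) (n : nat) :
  (birthday G <= n)%N -> game_ge (game_of_int n) G.
Proof.
elim: n G => [|n IH] G Gn; first by case: G Gn.
apply/game_geP; split=> // g gL; apply/negP => gn.
have : game_ge (game_of_int n) (game_of_int n.+1).
  by apply: game_ge_trans gn; apply: IH; have := birthday_left gL; lia.
by rewrite game_ge_int; lia.
Qed.

Lemma integer_floor (G : game) : exists n : int,
  game_ge G (game_of_int n) /\ ~~ game_ge G (game_of_int (n + 1)).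
Proof.
(* The shift by [b] turns the search into one over naturals: [G >= -b] excludes [k = 0], and
   [b >= G] refutes [G >= b + 1], which is [k = 2b + 1]. *)
pose b : int := birthday G; pose p k := ~~ game_ge G (game_of_int (k%:Z - b)).
have pE : exists k, p k.
  exists (birthday G + (birthday G).+1)%N; apply/negP => Gk.
  have /game_ge_trans/(_ Gk) := ge_of_birthday (leqnn (birthday G)).
  by rewrite game_ge_int; lia.
case: (ex_minnP pE) => -[|k] pk mink; last first.
  exists (k%:Z - b); split; last first.
    by rewrite (_ : _ + 1 = k.+1%:Z - b) //; lia.
  by apply: contraT => /mink; lia.
move: pk; rewrite /p add0r game_of_intN -[G]game_oppK game_ge_opp.
by rewrite ge_of_birthday // birthday_opp.
Qed.

(** * Scores of cooled games *)

(** Stated relative to the options so that it can serve inside the induction for [stops_opp]. *)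
Lemma rho_tilde_opp_of (G : game) (t : rat) :
  (forall g, g \in left_options G -> lambda t (game_opp g) = - rho t g) ->
  rho_tilde t (game_opp G) = (- lambda_tilde t G)%E.
Proof.
move=> IH; rewrite /rho_tilde /lambda_tilde right_options_opp big_map.
rewrite (big_morph _ oppe_max (erefl : (- -oo)%E = +oo%E)).
by apply: eq_big_seq => g gL; rewrite IH // -EFinN opprB addrC.
Qed.

(** Applied to the two scores, this says that [G] and [-G] have the same temperature. *)
Lemma first_agreement_opp (f g : rat -> \bar rat) :
  first_agreement (fun t => - g t)%E (fun t => - f t)%E = first_agreement f g.
Proof.
congr (xget 0 _); apply/seteqP; split=> t /= [td fg tmin]; split=> //.
- by apply: oppe_inj.
- by move=> s sd sfg; apply: tmin; rewrite ?sfg.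
- by rewrite fg.
- by move=> s sd /oppe_inj sfg; apply: tmin.
Qed.

(** The mirror symmetry that eliminates [lambda]: below, its properties are read off from [rho] of
    the negative game. *)
Lemma stops_opp (G : game) (t : rat) :
  lambda t (game_opp G) = - rho t G /\ rho t (game_opp G) = - lambda t G.
Proof.
elim/birthday_ind: G t => G IH t.
have rhoN s : rho_tilde s (game_opp G) = (- lambda_tilde s G)%E.
  by apply: rho_tilde_opp_of => g /birthday_left /IH /(_ s)[].
have lambdaN s : lambda_tilde s (game_opp G) = (- rho_tilde s G)%E.
  rewrite -[LHS]oppeK -rho_tilde_opp_of ?game_oppK // => g.
  rewrite left_options_opp => /mapP[h hR ->]; rewrite game_oppK.
  by have [_ ->] := IH _ (birthday_right hR) s; rewrite opprK.
rewrite /lambda /rho !stopsE.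
have [GZ|GZ] := pselect (equal_to_integer G).
  have -> : `[< equal_to_integer G >] = true by apply/asboolP.
  have -> : `[< equal_to_integer (game_opp G) >] = true.
    by apply/asboolP/equal_to_integer_opp.
  by rewrite /= integer_value_opp // mulrNz.
have -> : `[< equal_to_integer G >] = false by apply/asboolP.
have -> : `[< equal_to_integer (game_opp G) >] = false.
  by apply/asboolP => /equal_to_integer_opp.
rewrite (funext rhoN) (funext lambdaN) first_agreement_opp /=.
by split; case: ifP; rewrite ?rhoN ?lambdaN fineN.
Qed.

Lemma lambdaE (G : game) (t : rat) : lambda t G = - rho t (game_opp G).
Proof. by have [_ ->] := stops_opp G t; rewrite opprK. Qed.

Lemma lambda_tildeE (G : game) (t : rat) :
  lambda_tilde t G = (- rho_tilde t (game_opp G))%E.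
Proof.
by rewrite rho_tilde_opp_of ?oppeK // => g _; have [->] := stops_opp g t.
Qed.

Lemma lee_rho_tilde (G : game) (t : rat) (x : \bar rat) :
  (x <= rho_tilde t G)%E <->
  forall g, g \in right_options G -> (x <= (lambda t g + t)%:E)%E.
Proof.
split=> [xG g gR|xG]; first by apply: le_trans xG _; exact: ge_bigmin_seq.
rewrite /rho_tilde big_seq; apply: le_bigmin; first exact: leey.
exact: xG.
Qed.

Lemma rho_tilde_lee (G g : game) (t : rat) : g \in right_options G ->
  (rho_tilde t G <= (lambda t g + t)%:E)%E.
Proof. by move=> gR; exact: ge_bigmin_seq. Qed.

(** Some integer is not [<= G], and for a non-integer [G] only a Right option can be the cause. *)
Lemma right_options_neq_nil (G : game) : ~ equal_to_integer G ->
  exists g, g \in right_options G.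
Proof.
move=> GZ; have [n [_ Gn]] := integer_floor G.
by have [g gR _] := integer_avoidance GZ Gn; exists g.
Qed.

Lemma rho_tilde_attained (G : game) (t : rat) : ~ equal_to_integer G ->
  exists2 g, g \in right_options G & rho_tilde t G = (lambda t g + t)%:E.
Proof.
move=> /right_options_neq_nil[g gR]; rewrite /rho_tilde.
case: (right_options G) gR => // {}g s _.
elim: s g => [|h s IH] g.
  by exists g; rewrite ?mem_head // big_seq1.
rewrite big_cons; have [k kR ->] := IH h.
case: (leP (lambda t g + t)%:E (lambda t k + t)%:E) => _.
  by exists g; rewrite ?mem_head.
by exists k; rewrite // inE kR orbT.
Qed.

Definition cutoff (G : game) : rat :=
  first_agreement (lambda_tilde^~ G) (rho_tilde^~ G).

(* The first case is the junk value of [first_agreement]. *)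
Lemma cutoffP (G : game) :
  cutoff G = 0 \/ lambda_tilde (cutoff G) G = rho_tilde (cutoff G) G.
Proof.
rewrite /cutoff /first_agreement.
by case: xgetP => [t _ [_ -> _]|_]; [right|left].
Qed.

(** Freezing the score beyond the temperature amounts to freezing its argument. *)
Lemma rho_nonintegerE (G : game) (t : rat) : ~ equal_to_integer G ->
  rho t G = fine (rho_tilde (Num.min t (cutoff G)) G).
Proof.
move=> /asboolPn/negbTE GZ; rewrite /rho stopsE GZ /= -/(cutoff G).
by case: (leP t (cutoff G)).
Qed.

Lemma rho_tildeE (G : game) (t : rat) : ~ equal_to_integer G ->
  t <= cutoff G -> rho_tilde t G = (rho t G)%:E.
Proof.
move=> GZ tG; rewrite rho_nonintegerE // (min_idPl tG).
by have [g _ ->] := rho_tilde_attained t GZ.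
Qed.

Lemma rho_integer (G : game) (n : int) (t : rat) :
  game_eqv G (game_of_int n) -> rho t G = n%:~R.
Proof.
move=> Gn; have [|_ ->] := @stops_integer G t; first by exists n.
by rewrite (integer_valueE Gn).
Qed.

(** * Bounds on the stops by integers *)

Definition stop_slack (t : rat) : rat := Num.max t (- 1).

(** [stop_slack t] is the least [c] for which integers [k] obey both bounds: [k = n] asks for
    [t <= c], and [k = n - 1] for [-1 <= c]. *)
Definition rho_bounds (G : game) : Prop := forall (t : rat) (n : int),
  (game_ge G (game_of_int n) -> n%:~R + t - stop_slack t <= rho t G) /\
  (~~ game_ge G (game_of_int n) -> rho t G <= n%:~R + stop_slack t).

(** The two bounds for [-G^R] at [-n] turn into each other: [-(-n + c) + t = n + t - c] and
    [-(-n + t - c) + t = n + c]. The upper bound needs just one Right option [<= n], found by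
    [integer_avoidance]. *)
Lemma rho_tilde_bounds (G : game) (t : rat) (n : int) :
    (forall g, g \in right_options G -> rho_bounds (game_opp g)) ->
    ~ equal_to_integer G ->
  (game_ge G (game_of_int n) ->
    ((n%:~R + t - stop_slack t)%:E <= rho_tilde t G)%E) /\
  (~~ game_ge G (game_of_int n) ->
    (rho_tilde t G <= (n%:~R + stop_slack t)%:E)%E).
Proof.
move=> IH GZ; split=> Gn.
  apply/lee_rho_tilde => g gR; rewrite lee_fin lambdaE.
  have [_] := IH g gR t (- n); rewrite game_of_intN game_ge_opp.
  have /game_geP[/(_ g gR) ng _] := Gn.
  by move=> /(_ ng); rewrite mulrNz; lra.
have [g gR ng] := integer_avoidance GZ Gn.
apply: le_trans (rho_tilde_lee t gR) _; rewrite lee_fin lambdaE.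
have [+ _] := IH g gR t (- n); rewrite game_of_intN game_ge_opp.
by move=> /(_ ng); rewrite mulrNz; lra.
Qed.

(** With [m] the integer floor of [G], the Left score is at least [m - c] and the Right score at
    most [m + 1 + c]. Where they agree, [c >= -1/2], and since [c] is the maximum of the cutoff and
    -1, the cutoff is that large too. The junk value 0 also obeys the bound. *)
Lemma cutoff_ge (G : game) :
    (forall g, g \in right_options G -> rho_bounds (game_opp g)) ->
    (forall g, g \in left_options G -> rho_bounds g) ->
  ~ equal_to_integer G -> - 2^-1 <= cutoff G.
Proof.
move=> IHR IHL GZ.
have GNZ : ~ equal_to_integer (game_opp G) by move/equal_to_integer_opp.
have {}IHL g : g \in right_options (game_opp G) -> rho_bounds (game_opp g).
  by rewrite right_options_opp => /mapP[h /IHL + ->]; rewrite game_oppK.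
have [->//|] := cutoffP G; rewrite lambda_tildeE => agree.
have [m [Gm Gm1]] := integer_floor G.
have GNm : ~~ game_ge (game_opp G) (game_of_int (- m)).
  rewrite game_of_intN game_ge_opp; apply/negP => mG.
  by apply: GZ; exists m; apply/andP.
have [_ /(_ GNm)] := rho_tilde_bounds (cutoff G) (- m) IHL GNZ.
have [_ /(_ Gm1)] := rho_tilde_bounds (cutoff G) (m + 1) IHR GZ.
rewrite -agree; have [g _ ->] := rho_tilde_attained (cutoff G) GNZ.
rewrite -EFinN !lee_fin intrD mulrNz /stop_slack.
by case: (leP (cutoff G) (- 1)); lra.
Qed.

Lemma rho_boundsP (G : game) : rho_bounds G.
Proof.
elim/birthday_ind: G => G IH.
have IHR g : g \in right_options G -> rho_bounds (game_opp g).
  by move=> /birthday_right gG; apply: IH; rewrite birthday_opp.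
have IHL g : g \in left_options G -> rho_bounds g.
  by move=> /birthday_left /IH.
move=> t n; have [[k Gk]|GZ] := pselect (equal_to_integer G).
  rewrite (rho_integer t Gk) /stop_slack; have /andP[Gk1 Gk2] := Gk; split=> Gn.
    have := game_ge_trans Gk2 Gn; rewrite game_ge_int -(ler_int rat).
    by case: (leP t (- 1)); lra.
  have : k < n.
    by rewrite ltNge -game_ge_int; apply: contraNN Gn; exact: game_ge_trans.
  by rewrite -lezD1 -(ler_int rat) intrD; case: (leP t (- 1)); lra.
have cut := cutoff_ge IHR IHL GZ.
have [u] : exists u, u = Num.min t (cutoff G) by exists (Num.min t (cutoff G)).
rewrite rho_nonintegerE // => uE; rewrite -uE.
have [] := rho_tilde_bounds u n IHR GZ.
have [g _ ->] := rho_tilde_attained u GZ; rewrite !lee_fin /=.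
(* The bounds at [u] imply those at [t]: the slack is monotone, and [t - stop_slack t] is at most 0,
   with equality from -1 on, hence at the cutoff. *)
move=> lo up; split=> Gn; [move: (lo Gn)|move: (up Gn)]; move: cut uE; clear.
  by rewrite /stop_slack; case: (leP t (cutoff G)) => ? ? ->; 
  case: (leP t (- 1)); case: (leP (cutoff G) (- 1)); lra.
by rewrite /stop_slack; case: (leP t (cutoff G)) => ? ? ->; 
  case: (leP t (- 1)); case: (leP (cutoff G) (- 1)); lra.
Qed.

(** By induction [lambda] of a Right option has slopes in [[-1, 0]]. Adding [t] moves them to
    [[0, 1]], which minima and freezing preserve. *)
Lemma rho_lipschitz (G : game) (s t : rat) : s <= t ->
  rho s G <= rho t G <= rho s G + (t - s).
Proof.
elim/birthday_ind: G s t => G IH s t st.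
have [[k Gk]|GZ] := pselect (equal_to_integer G).
  by rewrite !(rho_integer _ Gk); lra.
have tilde u v : u <= v ->
    fine (rho_tilde u G) <= fine (rho_tilde v G)
      <= fine (rho_tilde u G) + (v - u).
  move=> uv; have [g gR gE] := rho_tilde_attained u GZ.
  have [h hR hE] := rho_tilde_attained v GZ.
  have := rho_tilde_lee u hR; have := rho_tilde_lee v gR.
  have IHR k : k \in right_options G ->
      rho u (game_opp k) <= rho v (game_opp k) <= rho u (game_opp k) + (v - u).
    by move=> /birthday_right kG; apply: IH; rewrite ?birthday_opp.
  move: (IHR _ gR) (IHR _ hR).
  by rewrite gE hE !lee_fin /= !lambdaE; lra.
rewrite !rho_nonintegerE //.
have : Num.min s (cutoff G) <= Num.min t (cutoff G) by exact: le_min2.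
move=> /tilde; case: (leP s (cutoff G)); case: (leP t (cutoff G)); lra.
Qed.

(** * Comparison with an integer read off at and just below 0 *)

Lemma rho0_ge (G : game) (n : int) :
  game_ge G (game_of_int n) -> n%:~R <= rho 0 G.
Proof.
by have [+ _] := rho_boundsP G 0 n; rewrite /stop_slack max_l // subr0 addr0.
Qed.

Lemma rho0_le (G : game) (n : int) :
  ~~ game_ge G (game_of_int n) -> rho 0 G <= n%:~R.
Proof.
by have [_] := rho_boundsP G 0 n; rewrite /stop_slack max_l // addr0.
Qed.

(** At a negative cutoff both scores would be [n] and the slack would be the cutoff itself. Failure
    of [G >= n] would then give [n <= n + cutoff < n], and likewise for [n >= G]; so [G] would equal
    [n]. *)
Lemma cutoff_ge0 (G : game) (n : int) : ~ equal_to_integer G ->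
  rho 0 G = n%:~R -> 0 <= cutoff G.
Proof.
move=> GZ rhon; rewrite leNgt; apply/negP => c0.
have GNZ : ~ equal_to_integer (game_opp G) by move/equal_to_integer_opp.
have cut : - 2^-1 <= cutoff G by apply: cutoff_ge => // g _; exact: rho_boundsP.
have slackE : stop_slack (cutoff G) = cutoff G.
  by rewrite /stop_slack max_l //; lra.
have rhoE : rho_tilde (cutoff G) G = n%:~R%:E.
  rewrite -rhon rho_nonintegerE // (min_idPr (ltW c0)).
  by have [g _ ->] := rho_tilde_attained (cutoff G) GZ.
have rhoNE : rho_tilde (cutoff G) (game_opp G) = (- n)%:~R%:E.
  (* The junk value 0 is ruled out by the assumption of a negative cutoff. *)
  have [cE|] := cutoffP G; first by rewrite cE ltxx in c0.
  by rewrite lambda_tildeE rhoE mulrNz EFinN => <-; rewrite oppeK.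
apply: (GZ); exists n; apply/andP; split; apply: contraT => nG.
  have [_ /(_ nG)] := rho_tilde_bounds (cutoff G) n (fun _ _ => rho_boundsP _) GZ.
  by rewrite rhoE slackE lee_fin; lra.
rewrite -game_ge_opp -game_of_intN in nG.
have [_ /(_ nG)] :=
  rho_tilde_bounds (cutoff G) (- n) (fun _ _ => rho_boundsP _) GNZ.
by rewrite rhoNE slackE lee_fin; lra.
Qed.

Lemma dyadic_near0 (e : rat) : 0 < e -> exists2 s, dyadic s & - e < s < 0.
Proof.
(* With [k] the integer part of [1/e], [2^k >= k + 1 > 1/e]. *)
move=> e0; exists (- (2 ^+ Num.truncn e^-1)^-1).
  by exists (-1), (Num.truncn e^-1); rewrite mulN1r.
rewrite oppr_lt0 invr_gt0 exprn_gt0 // andbT ltrN2.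
rewrite -[ltRHS]invrK ltf_pV2 ?posrE ?invr_gt0 ?exprn_gt0 //.
apply: lt_le_trans (truncnS_gt _) _; rewrite -natrX ler_nat.
exact: ltn_expl.
Qed.

(** If [G >= n], the lower bound [n] and monotonicity pin [rho] to [n] just below 0. Otherwise
    [rho_s <= n + s < n], and one dyadic [s] close to 0 refutes slope 0. *)
Lemma ge_slope (G : game) (n : int) : ~ equal_to_integer G ->
  rho 0 G = n%:~R ->
  game_ge G (game_of_int n) <-> slope_left_of_0 (rho_tilde^~ G) 0.
Proof.
move=> GZ rhon; have c0 := cutoff_ge0 GZ rhon.
have rhoE s : s <= 0 -> rho_tilde s G = (rho s G)%:E.
  by move=> s0; rewrite rho_tildeE //; lra.
split=> [Gn|[e e0 slope]].
  (* The slack of [s] is [s] itself down to -1, whence [delta = 1]. *)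
  exists 1 => // s _ /andP[s1 s0]; rewrite !rhoE // mul0r adde0.
  have [/(_ Gn) + _] := rho_boundsP G s n; have := rho_lipschitz G s0.
  rewrite rhon /stop_slack max_l; last lra.
  by move=> *; congr EFin; lra.
have [|s sd] := @dyadic_near0 (Num.min e 1); first by rewrite lt_min e0 ltr01.
move=> /andP[es s0].
have {es} [es s1] : - e < s /\ - 1 < s.
  by move: es; case: (leP e 1); lra.
apply: contraT => Gn; have [_ /(_ Gn)] := rho_boundsP G s n.
have [->] : (rho s G)%:E = (n%:~R)%:E :> \bar rat.
  by rewrite -rhoE ?(ltW s0) // slope ?es ?(ltW s0) // mul0r adde0 rhoE // rhon.
by rewrite /stop_slack max_l ?(ltW s1) //; lra.
Qed.

(** * The bounds [l] and [r] and the set [S] *)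

Lemma lee_max_left (G : game) (x : \bar rat) :
  (max_left G <= x)%E <->
  forall g, g \in left_options G -> ((rho 0 g)%:E <= x)%E.
Proof.
split=> [Gx g gL|Gx]; first by apply: le_trans Gx; exact: le_bigmax_seq.
rewrite /max_left big_seq; apply: bigmax_le; first exact: leNye.
exact: Gx.
Qed.

(** Among the options attaining an integral [M], (i) and (ii) single out those that exclude [M]
    itself from [S]. *)
Lemma ge_cond (G g : game) (n : int) : max_left G = n%:~R%:E ->
  rho 0 g = n%:~R ->
  game_ge g (game_of_int n) <-> cond_i G g \/ cond_ii G g.
Proof.
move=> Mn gn; split=> [gen|[[m]|[_ _ gZ gslope]]]; last first.
- exact/(ge_slope gZ gn).
- by rewrite Mn => -[/intr_inj <-] /andP[].
have [[k gk]|gZ] := pselect (equal_to_integer g).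
  left; exists n => //; rewrite -(_ : k = n) //.
  by move: gn; rewrite (rho_integer _ gk) => /intr_inj.
by right; split; [exists n|rewrite Mn gn| |exact/(ge_slope gZ gn)].
Qed.

(** An option [g >= n] has [rho_0(g) >= n] and so forces [n <= M]; if there is none, [M <= n]. Only
    [n = M] remains in doubt, and there (i) and (ii) decide. *)
Lemma lower_boundP (G : game) (n : int) :
  (lower_bound G <= n%:~R%:E)%E <->
  forall g, g \in left_options G -> ~~ game_ge g (game_of_int n).
Proof.
have below_le : (forall g, g \in left_options G -> ~~ game_ge g (game_of_int n)) ->
    (max_left G <= n%:~R%:E)%E.
  by move=> Gn; apply/lee_max_left => g /Gn /rho0_le; rewrite lee_fin.
rewrite /lower_bound; case: asboolP => [[g gL cg]|ncond]; last split.
- have [k Mk] : exists k : int, max_left G = k%:~R%:E.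
    by case: cg => [[k]|[]] //; exists k.
  have gk : rho 0 g = k%:~R.
    case: cg => [[m]|[_ + _ _]]; rewrite Mk; last by case.
    by move=> -[/intr_inj <-]; exact: rho_integer.
  have k_ge : game_ge g (game_of_int k) by apply/(ge_cond Mk gk).
  have -> : (max_left G + 1 <= n%:~R%:E)%E = (k < n).
    by rewrite Mk -EFinD lee_fin -lezD1 -(ler_int rat) intrD.
  split=> [kn h hL|Gn].
    apply/negP => /rho0_ge nh; have /lee_max_left/(_ h hL) := lexx (max_left G).
    by rewrite Mk lee_fin; move: kn; rewrite -(ltr_int rat); lra.
  rewrite lt_neqAle -(ler_int rat) -lee_fin -Mk below_le // andbT.
  by apply: contraTneq k_ge => ->; exact: Gn.
- move=> Mn g gL; apply/negP => gn.
  have ng := rho0_ge gn.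
  have /lee_max_left/(_ g gL) := Mn; rewrite lee_fin => gn'.
  have rhon : rho 0 g = n%:~R by apply/le_anti; rewrite ng gn'.
  apply: ncond; exists g => //; apply/(ge_cond _ rhon) => //.
  apply/le_anti; rewrite Mn -rhon; exact: le_bigmax_seq.
- exact: below_le.
Qed.

Lemma max_left_opp (G : game) : max_left (game_opp G) = (- min_right G)%E.
Proof.
rewrite /max_left /min_right left_options_opp big_map.
rewrite (big_morph _ oppe_min (erefl : (- +oo)%E = -oo%E)).
by apply: eq_bigr => g _; rewrite lambdaE EFinN oppeK.
Qed.

Lemma min_rightE (G : game) : min_right G = (- max_left (game_opp G))%E.
Proof. by rewrite max_left_opp oppeK. Qed.

Lemma cond_iii_opp (G g : game) :
  cond_iii G g <-> cond_i (game_opp G) (game_opp g).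
Proof.
split=> -[n].
  move=> Gn gn; exists (- n); first by rewrite max_left_opp Gn mulrNz EFinN.
  by rewrite game_eqv_opp opprK.
move=> Gn; rewrite game_eqv_opp => gn; exists (- n) => //.
by rewrite min_rightE Gn mulrNz EFinN.
Qed.

Lemma cond_iv_opp (G g : game) :
  cond_iv G g <-> cond_ii (game_opp G) (game_opp g).
Proof.
have slopeN : slope_left_of_0 (lambda_tilde^~ g) 0 <->
    slope_left_of_0 (rho_tilde^~ (game_opp g)) 0.
  split=> -[e e0 slope]; exists e => // s sd /(slope s sd).
    by rewrite !lambda_tildeE !mul0r !adde0 => /oppe_inj.
  by rewrite !lambda_tildeE !mul0r !adde0 => ->.
split=> -[[n Gn] Gg gZ gs]; split.
- by exists (- n); rewrite max_left_opp Gn mulrNz EFinN.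
- by rewrite max_left_opp -Gg lambdaE EFinN oppeK.
- by move/equal_to_integer_opp.
- exact/slopeN.
- by exists (- n); rewrite min_rightE Gn mulrNz EFinN.
- by rewrite min_rightE -Gg lambdaE EFinN.
- by move/equal_to_integer_opp.
- exact/slopeN.
Qed.

Lemma upper_boundE (G : game) :
  upper_bound G = (- lower_bound (game_opp G))%E.
Proof.
rewrite /upper_bound /lower_bound min_rightE.
rewrite (_ : `[< _ >] = `[< exists2 g, g \in left_options (game_opp G) &
    cond_i (game_opp G) g \/ cond_ii (game_opp G) g >]).
  (* Negation distributes over the sum because the summand 1 is finite. *)
  by case: ifP => // _; rewrite fin_num_oppeD.
apply: asbool_equiv_eq; rewrite left_options_opp; split.
  move=> [g gR cg]; exists (game_opp g); first by rewrite map_f.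
  by rewrite -cond_iii_opp -cond_iv_opp.
move=> [_ /mapP[g gR ->] cg]; exists g => //.
by rewrite cond_iii_opp cond_iv_opp.
Qed.

(** The link between the stops and the simplicity theorem; the Right half is [lower_boundP] for
    [-G]. *)
Lemma candidatesE (G : game) (n : int) : candidates G n <-> fits G n.
Proof.
rewrite /candidates /= upper_boundE leeNr -EFinN -mulrNz.
rewrite !lower_boundP /fits left_options_opp.
split=> -[GL GR]; split=> // g.
  by move=> gR; rewrite -game_ge_opp -game_of_intN; apply: GR; rewrite map_f.
by move=> /mapP[h hR ->]; rewrite game_of_intN game_ge_opp; exact: GR.
Qed.

(** Two distinct fits of equal absolute value are opposite, so 0 lies between them; it then fits too
    and is smaller in absolute value. *)
Lemma simplest_fit_unique (G : game) (m n : int) : fits G m -> fits G n ->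
  `|m| = `|n| -> (forall k, fits G k -> `|m| <= `|k|) -> m = n.
Proof.
wlog mn : m n / m <= n => [wlogH|] Gm Gn mnE minm.
  have [mn|/ltW nm] := leP m n; first exact: wlogH.
  by apply/esym/wlogH => //; rewrite -mnE.
have [//|mN0] := eqVneq m n.
suff /minm : fits G 0 by lia.
split=> g gO; apply/negP => g0.
  have /negP := (Gm.1 _ gO); apply; apply: game_ge_trans g0 _.
  by rewrite game_ge_int; lia.
have /negP := (Gn.2 _ gO); apply; apply: game_ge_trans g0.
by rewrite game_ge_int; lia.
Qed.

Theorem theorem20 (G : game) :
  (candidates G = set0 -> ~ equal_to_integer G) /\
  (candidates G <> set0 ->
    exists n : int,
      unique (fun k : int => candidates G k /\
                forall j : int, candidates G j -> `|k| <= `|j|) n /\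
      game_eqv G (game_of_int n)).
Proof.
split=> [G0 [n /eqv_fits/candidatesE]|/eqP/set0P[n /candidatesE Gn]].
  by rewrite G0.
have [m Gm minm] := simplest_fit Gn.
exists m; split; last exact: simplest_fit_eqv.
split=> [|k [/candidatesE Gk mink]].
  by split=> [|j /candidatesE]; [exact/candidatesE|exact: minm].
apply: (simplest_fit_unique Gm Gk) => //.
by apply/le_anti; rewrite minm // mink //; exact/candidatesE.
Qed.
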